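(* Let $\mathbb{X}$ and $\mathbb{Y}$ be real normed spaces and let $T \in K(\mathbb{X},\mathbb{Y})$. Then $T$ is a smooth point of $K(\mathbb{X},\mathbb{Y})$ if and only if $T^*$ attains its norm at a unique (up to scalar multiplication) vector $g \in S_{\mathbb{Y}^*}$, i.e. $\{h \in S_{\mathbb{Y}^*} : \|T^*h\| = \|T^*\|\} = \{g, -g\}$ for some $g \in S_{\mathbb{Y}^*}$, and $T^*g$ is a smooth point of $\mathbb{X}^*$.
   Context: $\mathbb{X}^*, \mathbb{Y}^*$ are the (norm) dual spaces and $T^* : \mathbb{Y}^* \to \mathbb{X}^*$ is the adjoint operator of $T$. $S_{\mathbb{Y}^*} = \{h \in \mathbb{Y}^* : \|h\| = 1\}$. $K(\mathbb{X},\mathbb{Y})$ is the normed space of compact linear operators from $\mathbb{X}$ to $\mathbb{Y}$ with the operator norm. A non-zero element $u$ of a real normed space $\mathbb{Z}$ is a smooth point of $\mathbb{Z}$ if there is a unique linear functional $f \in \mathbb{Z}^*$ with $\|f\| = 1$ and $f(u) = \|u\|$. *)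

(* Defs.v *)
From HB Require Import structures.
From mathcomp Require Import all_boot all_order all_algebra.
From mathcomp Require Import all_classical all_reals all_analysis.

Set Implicit Arguments.
Unset Strict Implicit.
Unset Printing Implicit Defensive.

Import Order.TTheory GRing.Theory Num.Theory.
Import numFieldNormedType.Exports.

Local Open Scope classical_set_scope.
Local Open Scope ring_scope.

Section BoundedOperators.
Context (R : realType) (X Y : normedModType R).

(* For linear maps between normed spaces, continuous means bounded. *)
Definition bounded_op_pred : {pred X -> Y} :=
  fun f => `[< linear f /\ continuous f >].

Record bounded_op := BoundedOp {
  bounded_op_fun :> X -> Y;
  _ : bounded_op_fun \in bounded_op_pred }.

HB.instance Definition _ := [isSub for bounded_op_fun].
HB.instance Definition _ := [Choice of bounded_op by <:].

Lemma bounded_op_closed : subsemimod_closed bounded_op_pred.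
Proof.
split; first split.
- apply/asboolP; split; first by move=> a u v; rewrite scaler0 addr0.
  by move=> x; exact: cst_continuous.
- move=> f g /asboolP[lf cf] /asboolP[lg cg]; apply/asboolP; split.
    by move=> a u v; rewrite addrfctE lf lg scalerDr addrACA.
  by move=> x; apply: continuousD; [exact: cf | exact: cg].
- move=> a f /asboolP[lf cf]; apply/asboolP; split.
    by move=> b u v; rewrite scalrfctE lf scalerDr !scalerA mulrC.
  by move=> x; apply: cvgZr; exact: cf.
Qed.

HB.instance Definition _ :=
  GRing.isSubmodClosed.Build R (X -> Y) bounded_op_pred bounded_op_closed.
HB.instance Definition _ := [SubChoice_isSubLmodule of bounded_op by <:].

Lemma bounded_op_linear (T : bounded_op) : linear T.
Proof. by case: T => f /= /asboolP[]. Qed.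

HB.instance Definition _ (T : bounded_op) :=
  GRing.isLinear.Build R X Y *:%R T (bounded_op_linear T).

Lemma bounded_op_continuous (T : bounded_op) : continuous T.
Proof. by case: T => f /= /asboolP[]. Qed.

Lemma bounded_op_addE (S T : bounded_op) x : (S + T) x = S x + T x.
Proof. by []. Qed.

Lemma bounded_op_scaleE a (T : bounded_op) x : (a *: T) x = a *: T x.
Proof. by []. Qed.

Definition op_norm (T : bounded_op) : R :=
  sup [set `|T x| | x in [set x : X | `|x| <= 1]].

Lemma op_norm_has_sup (T : bounded_op) :
  has_sup [set `|T x| | x in [set x : X | `|x| <= 1]].
Proof.
split; first by exists `|T 0|, 0 => //=; rewrite normr0.
have /linear_bounded_continuous/bounded_funP/(_ 1)[M TM] :=
  @bounded_op_continuous T.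
by exists M => _ [x x1 <-]; exact: TM.
Qed.

Lemma op_norm_ub (T : bounded_op) x : `|x| <= 1 -> `|T x| <= op_norm T.
Proof.
move=> x1; apply: ub_le_sup; first exact: (op_norm_has_sup T).2.
by exists x.
Qed.

Lemma op_norm_lub (T : bounded_op) M :
  (forall x, `|x| <= 1 -> `|T x| <= M) -> op_norm T <= M.
Proof.
move=> TM; apply: ge_sup; first exact: (op_norm_has_sup T).1.
by move=> _ [x x1 <-]; exact: TM.
Qed.

Lemma op_norm_ge0 T : 0 <= op_norm T.
Proof. by apply: le_trans (op_norm_ub T (x := 0) _); rewrite ?normr0. Qed.

Lemma op_norm_le (T : bounded_op) x : `|T x| <= op_norm T * `|x|.
Proof.
have [->|x0] := eqVneq x 0; first by rewrite linear0 !normr0 mulr0.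
have nx0 : 0 < `|x| by rewrite normr_gt0.
rewrite -ler_pdivrMr//.
have := @op_norm_ub T (`|x|^-1 *: x); rewrite linearZ !normrZ normfV normr_id.
by rewrite mulVf ?gt_eqF// mulrC; apply.
Qed.

Lemma op_normD S T : op_norm (S + T) <= op_norm S + op_norm T.
Proof.
apply: op_norm_lub => x x1; rewrite bounded_op_addE.
by rewrite (le_trans (ler_normD _ _))// lerD// op_norm_ub.
Qed.

Lemma op_normZ_le a T : op_norm (a *: T) <= `|a| * op_norm T.
Proof.
apply: op_norm_lub => x x1; rewrite bounded_op_scaleE normrZ.
by rewrite ler_wpM2l// op_norm_ub.
Qed.

Lemma op_normZ a T : op_norm (a *: T) = `|a| * op_norm T.
Proof.
apply/eqP; rewrite eq_le op_normZ_le/=.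
have [->|a0] := eqVneq a 0; first by rewrite normr0 mul0r op_norm_ge0.
rewrite -ler_pdivlMl ?normr_gt0// -normfV.
by rewrite -[in leLHS](scalerK a0 T) op_normZ_le.
Qed.

Lemma op_norm_eq0 T : op_norm T = 0 -> T = 0.
Proof.
move=> T0; apply/val_inj/funext => x /=.
by apply/eqP; rewrite -normr_le0 (le_trans (op_norm_le T x))// T0 mul0r.
Qed.

HB.instance Definition _ :=
  Lmodule_isNormed.Build R bounded_op op_normD op_normZ op_norm_eq0.

Lemma bounded_op_normE (T : bounded_op) : `|T| = op_norm T.
Proof. by []. Qed.

End BoundedOperators.

Arguments BoundedOp {R X Y} _ _.

Definition dual (R : realType) (X : normedModType R) := bounded_op X R^o.

HB.instance Definition _ (R : realType) (X : normedModType R) :=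
  NormedModule.copy (dual X) (bounded_op X R^o).
HB.instance Definition _ (R : realType) (X : normedModType R) (f : dual X) :=
  GRing.Linear.copy (f : X -> R^o) (bounded_op_fun f).

Section Adjoint.
Context (R : realType) (X Y : normedModType R) (T : bounded_op X Y).

Lemma adjoint_fun_subproof (g : dual Y) :
  (g \o T : X -> R^o) \in @bounded_op_pred R X R^o.
Proof.
apply/asboolP; split; first by move=> a u v; rewrite /= !linearP.
move=> x; apply: continuous_comp; exact: bounded_op_continuous.
Qed.

Definition adjoint_fun (g : dual Y) : dual X :=
  BoundedOp (g \o T) (adjoint_fun_subproof g).

Lemma adjoint_subproof : adjoint_fun \in @bounded_op_pred R (dual Y) (dual X).
Proof.
have lT : linear adjoint_fun by move=> a g h; exact/val_inj/funext.
apply/asboolP; split => //.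
pose lA := GRing.isLinear.Build R (dual Y) (dual X) *:%R adjoint_fun lT.
pose A : {linear dual Y -> dual X} := HB.pack adjoint_fun lA.
suff: continuous A by [].
apply/linear_bounded_continuous/bounded_funP => r; exists (r * `|T|) => g gr.
apply: op_norm_lub => x x1 /=; apply: le_trans (op_norm_le g _) _.
by rewrite ler_pM// ?op_norm_ge0//; exact: op_norm_ub.
Qed.

Definition adjoint : bounded_op (dual Y) (dual X) :=
  BoundedOp adjoint_fun adjoint_subproof.

Lemma adjointE (g : dual Y) x : adjoint g x = g (T x).
Proof. by []. Qed.

End Adjoint.

Section CompactOperators.
Context (R : realType) (X Y : normedModType R).

(* [precompact B] says that the closure of [B] in Y is compact; Y need not be
   complete. A linear map sending bounded sets to such sets is automatically
   bounded, so looking only at bounded operators loses nothing. *)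
Definition compact_op_pred : {pred bounded_op X Y} :=
  fun T => `[< forall A : set X, bounded_set A -> precompact (T @` A) >].

Record compact_op := CompactOp {
  compact_op_val :> bounded_op X Y;
  _ : compact_op_val \in compact_op_pred }.

HB.instance Definition _ := [isSub for compact_op_val].
HB.instance Definition _ := [Choice of compact_op by <:].

Lemma compact_op_closed : subsemimod_closed compact_op_pred.
Proof.
have sub_cpt (B C : set Y) : B `<=` C -> compact C -> compact (closure B).
  move=> BC cC; rewrite -precompactE; apply: (precompact_subset BC).
  by apply: compact_precompact => //; exact: norm_hausdorff.
split; first split.
- apply/asboolP => A _; rewrite precompactE.
  apply: (sub_cpt _ [set 0]); last exact: compact_set1.
  by move=> _ [x _ <-].
- move=> S T /asboolP cS /asboolP cT; apply/asboolP => A bA.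
  have := cS _ bA; have := cT _ bA; rewrite !precompactE => cTA cSA.
  apply: (sub_cpt _ [set p.1 + p.2 |
      p in closure (S @` A) `*` closure (T @` A)]).
    move=> _ [x Ax <-]; exists (S x, T x) => //=.
    by split; apply: subset_closure; exists x.
  apply: continuous_compact; last exact: compact_setX.
  by apply: continuous_subspaceT; exact: add_continuous.
- move=> a T /asboolP cT; apply/asboolP => A bA.
  have := cT _ bA; rewrite !precompactE => cTA.
  apply: (sub_cpt _ [set a *: y | y in closure (T @` A)]).
    move=> _ [x Ax <-]; exists (T x) => //.
    by apply: subset_closure; exists x.
  apply: continuous_compact => //; apply: continuous_subspaceT.
  exact: scaler_continuous.
Qed.

HB.instance Definition _ := GRing.isSubmodClosed.Build R (bounded_op X Y)
  compact_op_pred compact_op_closed.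
HB.instance Definition _ := [SubChoice_isSubLmodule of compact_op by <:].

Definition compact_op_norm (T : compact_op) : R := `|compact_op_val T|.

Lemma compact_op_normD S T :
  compact_op_norm (S + T) <= compact_op_norm S + compact_op_norm T.
Proof. exact: ler_normD. Qed.

Lemma compact_op_normZ a T :
  compact_op_norm (a *: T) = `|a| * compact_op_norm T.
Proof. exact: normrZ. Qed.

Lemma compact_op_norm_eq0 T : compact_op_norm T = 0 -> T = 0.
Proof. by move=> /normr0_eq0 T0; exact/val_inj. Qed.

HB.instance Definition _ := Lmodule_isNormed.Build R compact_op
  compact_op_normD compact_op_normZ compact_op_norm_eq0.

Lemma compact_op_normE (T : compact_op) : `|T| = `|T : bounded_op X Y|.
Proof. by []. Qed.

End CompactOperators.

Definition smooth_point (R : realType) (Z : normedModType R) (u : Z) : Prop :=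
  u != 0 /\ exists! f : dual Z, `|f| = 1 /\ f u = `|u|.

(* Main.v *)
(** Passing to a limit along an ultrafilter, pairs [(x_n, h_n)] in the unit
    balls of [X] and [Y^*] yield functionals [F] on [X^*] and [g] on [Y] of norm
    at most 1 with [h_n (A x_n) --> F (A^* g)] for every compact [A]. Taking
    pairs that almost norm [T + A / n], every norm-one [P] with [P T = |T|]
    satisfies [P A <= F (A^* g)] for some [(F, g)], depending on [A], with
    [F (T^* g) = |T|]. If [T^*] attains its norm only at [+-g] and [T^* g] is
    smooth, then [(F, g)] is unique up to a common sign, whence [P] is unique.
    Conversely each such [(F, g)] defines a support functional
    [A |-> F (A^* g)] of [T]; when that functional is unique, testing it on
    rank-one operators determines [g] up to sign and [F] given [g]. *)

Require Import Defs.
From HB Require Import structures.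
From mathcomp Require Import all_boot all_order all_algebra.
From mathcomp Require Import all_classical all_reals all_analysis.
From mathcomp Require Import lra.
Import Order.TTheory GRing.Theory Num.Theory.
Import numFieldNormedType.Exports.
Local Open Scope classical_set_scope.
Local Open Scope ring_scope.

(** * Hahn-Banach by minimal sublinear functionals *)

Section HahnBanach.
Context {R : realType} {V : lmodType R}.

(** Homogeneity is asked only as an inequality, which passes easily to infima; rescaling by the
    inverse scalar recovers equality in [sublinearZ]. *)
Definition sublinear (p : V -> R) : Prop :=
  (forall x y, p (x + y) <= p x + p y) /\
  (forall t x, 0 <= t -> p (t *: x) <= t * p x).

Section Sublinear.
Context {p : V -> R}.
Context (sp : sublinear p).

Lemma sublinearZ t x : 0 <= t -> p (t *: x) = t * p x.
Proof.
have p0 : p 0 = 0.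
  have p0 : p 0 <= 0.
    by rewrite -[in leLHS](scale0r 0) (le_trans (sp.2 _ _ _))// mul0r.
  by apply/eqP; rewrite eq_le p0 -(lerD2l (p 0)) addr0 -{1}(addr0 0) sp.1.
rewrite le_eqVlt => /predU1P[<-|t0]; first by rewrite scale0r mul0r.
apply/eqP; rewrite eq_le (sp.2 _ _ (ltW t0))/= -ler_pdivlMl//.
by rewrite -{1}(scalerK (lt0r_neq0 t0) x) sp.2// invr_ge0 ltW.
Qed.

Lemma sublinear0 : p 0 = 0.
Proof. by rewrite -(scale0r 0) sublinearZ// mul0r. Qed.

Lemma sublinearN x : - p (- x) <= p x.
Proof. by rewrite lerNl -subr_ge0 opprK addrC -sublinear0 -(subrr x) sp.1. Qed.

(** The hypothesis and [sublinearN] make [p] odd; subadditivity at [x + y] and [- y] then yields the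
    reverse of subadditivity. *)
Lemma sublinear_odd_linear :
  (forall x, p x + p (- x) <= 0) -> linear (p : V -> R^o).
Proof.
move=> podd.
have pN x : p (- x) = - p x by have := podd x; have := sublinearN x; lra.
have pD x y : p (x + y) = p x + p y.
  have := sp.1 x y; have := sp.1 (x + y) (- y); rewrite addrK pN; lra.
move=> a x y; rewrite pD; congr (_ + _).
have [/sublinearZ//|a0] := leP 0 a.
have /sublinearZ : 0 <= - a by rewrite oppr_ge0 ltW.
by move=> /(_ x); rewrite scaleNr pN mulNr => /oppr_inj.
Qed.

(** Lowers [p] to a sublinear functional whose value at [- y] is at most [- p y], so a minimal [p]
    must be odd. *)
Definition sublinear_shift (y x : V) : R :=
  inf [set p (x + t *: y) - t * p y | t in [set t : R | 0 <= t]].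

Let has_inf_shift y x :
  has_inf [set p (x + t *: y) - t * p y | t in [set t : R | 0 <= t]].
Proof.
split; first by exists (p (x + 0 *: y) - 0 * p y), 0 => /=.
exists (- p (- x)) => _ [t /= t0 <-].
have := sp.1 (x + t *: y) (- x).
by rewrite addrAC subrr add0r sublinearZ//; lra.
Qed.

Let shift_le y x t : 0 <= t -> sublinear_shift y x <= p (x + t *: y) - t * p y.
Proof. by move=> t0; apply: ge_inf; [exact: (has_inf_shift y x).2|exists t]. Qed.

Let le_shift y x a :
  (forall t, 0 <= t -> a <= p (x + t *: y) - t * p y) -> a <= sublinear_shift y x.
Proof.
move=> h; apply: lb_le_inf; first exact: (has_inf_shift y x).1.
by move=> _ [t /= t0 <-]; exact: h.
Qed.

Lemma sublinear_shift_le y x : sublinear_shift y x <= p x.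
Proof. by have := shift_le y x 0 (lexx 0); rewrite scale0r addr0 mul0r subr0. Qed.

Lemma sublinear_shiftN y : sublinear_shift y (- y) <= - p y.
Proof.
have := shift_le y (- y) 1 ler01.
by rewrite scale1r addNr sublinear0 mul1r sub0r.
Qed.

Lemma sublinear_shift_sublinear y : sublinear (sublinear_shift y).
Proof.
split=> [x x'|s x].
  rewrite -lerBlDr; apply: le_shift => t t0.
  rewrite lerBlDr -lerBlDl; apply: le_shift => t' t'0.
  rewrite lerBlDl (le_trans (shift_le _ _ _ (addr_ge0 t0 t'0)))//.
  have := sp.1 (x + t *: y) (x' + t' *: y).
  by rewrite addrACA -scalerDl; lra.
rewrite le_eqVlt => /predU1P[<-|s0].
  by rewrite scale0r mul0r -sublinear0 sublinear_shift_le.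
rewrite -ler_pdivrMl//; apply: le_shift => t t0; rewrite ler_pdivrMl//.
have st0 : 0 <= s * t by rewrite mulr_ge0// ltW.
rewrite (le_trans (shift_le _ _ _ st0))//.
by rewrite -scalerA -scalerDr (sublinearZ _ _ (ltW s0)) mulrBr mulrA.
Qed.
End Sublinear.

(** Zorn gives a minimal sublinear functional below [q]; it equals all its shifts, hence is odd,
    hence linear. *)
Lemma sublinear_dominates_linear (q : V -> R) : sublinear q ->
  exists2 f : V -> R, linear (f : V -> R^o) & forall x, f x <= q x.
Proof.
move=> sq.
pose below (p : V -> R) := sublinear p /\ forall x, p x <= q x.
pose T := {p : V -> R | below p}.
(* The order is reversed, so a Zorn-maximal element is a minimal functional. *)
pose ge (s t : T) := `[< forall x, sval t x <= sval s x >].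
suff [p0 pmin] : exists t, forall s, ge t s -> s = t.
  move: p0 pmin => [p [sp pq]] pmin.
  exists p => //; apply: sublinear_odd_linear => // y.
  have bs : below (@sublinear_shift p y).
    split; first exact: sublinear_shift_sublinear.
    by move=> x; rewrite (le_trans _ (pq x))// sublinear_shift_le.
  have /(congr1 sval)/= ps := pmin (exist _ _ bs)
    (asboolT (sublinear_shift_le sp y)).
  by rewrite addrC -lerBrDr sub0r -[in leLHS]ps sublinear_shiftN.
apply: Zorn.
- by move=> s; apply/asboolP.
- move=> r s t /asboolP rs /asboolP st; apply/asboolP => x.
  exact: le_trans (st x) (rs x).
- move=> [s Hs] [t Ht] /asboolP/= st /asboolP/= ts; apply/eq_exist/funext => x.
  by apply/eqP; rewrite eq_le st ts.
- move=> A Atot.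
  have [A0|/set0P[s0 As0]] := eqVneq A set0.
    by exists (exist _ q (conj sq (fun=> lexx _))) => s; rewrite A0.
  pose E x := [set sval s x | s in A].
  have infE x : has_inf (E x).
    split; first by exists (sval s0 x), s0.
    exists (- q (- x)) => _ [[s [ss sleq]] _ <-] /=.
    by rewrite (le_trans _ (sublinearN ss _))// lerN2.
  have infE_le x s : A s -> inf (E x) <= sval s x.
    by move=> As; apply: ge_inf; [exact: (infE x).2|exists s].
  have le_infE x a : (forall s, A s -> a <= sval s x) -> a <= inf (E x).
    move=> h; apply: lb_le_inf; first exact: (infE x).1.
    by move=> _ [s As <-]; exact: h.
  suff Hb : below (fun x => inf (E x)).
    by exists (exist _ _ Hb) => s As; apply/asboolP => x; exact: infE_le.
  split=> [|x]; last exact: le_trans (infE_le x _ As0) ((svalP s0).2 x).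
  split=> [x y|t x].
    rewrite -lerBlDr; apply: (le_infE) => s As.
    rewrite lerBlDr -lerBlDl; apply: (le_infE) => s' As'.
    (* The smaller of the two chain members bounds both summands. *)
    rewrite lerBlDl; have [/asboolP ss'|/asboolP s's] := Atot _ _ As As'.
    + rewrite (le_trans (infE_le _ _ As'))//.
      by rewrite (le_trans ((svalP s').1.1 _ _))// lerD.
    + rewrite (le_trans (infE_le _ _ As))//.
      by rewrite (le_trans ((svalP s).1.1 _ _))// lerD.
  rewrite le_eqVlt => /predU1P[<-|t0].
    rewrite scale0r mul0r (le_trans (infE_le _ _ As0))//.
    by rewrite (sublinear0 (svalP s0).1).
  rewrite -ler_pdivrMl//; apply: (le_infE) => s As; rewrite ler_pdivrMl//.
  by rewrite (le_trans (infE_le _ _ As))// (svalP s).1.2// ltW.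
Qed.
End HahnBanach.

(** * Functionals on a normed space and its bidual *)

Section DualElements.
Context {R : realType} {Z : normedModType R}.

Lemma dual_of_linear (f : Z -> R) (M : R) : 0 <= M -> linear (f : Z -> R^o) ->
  (forall z, `|f z| <= M * `|z|) ->
  exists2 F : dual Z, (forall z, F z = f z) & `|F| <= M.
Proof.
move=> M0 lf fM.
pose lfm := GRing.isLinear.Build R Z R^o *:%R (f : Z -> R^o) lf.
pose fl : {linear Z -> R^o} := HB.pack (f : Z -> R^o) lfm.
have fin : (f : Z -> R^o) \in @bounded_op_pred R Z R^o.
  apply/asboolP; split => //.
  suff: continuous fl by [].
  apply/linear_bounded_continuous/linear_boundedP.
  exists M; split; first exact: num_real.
  by move=> r Mr z; rewrite (le_trans (fM z))// ler_wpM2r// ltW.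
exists (BoundedOp (f : Z -> R^o) fin) => //.
by apply: op_norm_lub => z z1 /=; rewrite (le_trans (fM z))// ler_piMr.
Qed.

Lemma dual_le (f : dual Z) z M : `|f| <= M -> `|f z| <= M * `|z|.
Proof. by move=> fM; rewrite (le_trans (op_norm_le f z))// ler_wpM2r. Qed.

(** Dominating by the norm shifted at [z] forces [f (- z) <= - |z|], so no extension from a line is
    required. The bound is [<= 1] since [Z] may be zero. *)
Lemma norming_functional (z : Z) : exists2 f : dual Z, `|f| <= 1 & f z = `|z|.
Proof.
have sN : sublinear (fun x : Z => `|x|).
  split=> [x y|t x t0]; first exact: ler_normD.
  by rewrite normrZ ger0_norm.
have [f lf fq] := sublinear_dominates_linear _
  (sublinear_shift_sublinear sN z).
pose lfm := GRing.isLinear.Build R Z R^o *:%R (f : Z -> R^o) lf.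
pose fl : {linear Z -> R^o} := HB.pack (f : Z -> R^o) lfm.
have fN x : f (- x) = - f x by exact: (linearN fl).
have fle x : f x <= `|x| := le_trans (fq x) (sublinear_shift_le sN z x).
have [|F Ff F1] := dual_of_linear f 1 ler01 lf.
  by move=> x; rewrite mul1r ler_norml fle andbT lerNl -fN -[leRHS]normrN fle.
exists F => //; apply/eqP; rewrite Ff eq_le fle /=.
by rewrite -lerN2 -fN (le_trans (fq _))// sublinear_shiftN.
Qed.

End DualElements.

Lemma dual_eval {R : realType} {Z : normedModType R} (z : Z) :
  exists2 F : dual (dual Z), (forall f, F f = f z) & `|F| <= `|z|.
Proof.
have le : linear ((fun f : dual Z => f z : R) : dual Z -> R^o) by [].
apply: (@dual_of_linear _ (dual Z) _ _ (normr_ge0 z) le) => f.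
by rewrite mulrC; exact: op_norm_le.
Qed.

(** * Limits along an ultrafilter *)

Section Ultralimits.
Context {I : Type} {U : set_system I} {UU : UltraFilter U}.

(** A cluster point of an ultrafilter is a limit: otherwise the complement of some neighbourhood
    would be in the filter. *)
Lemma compact_ultra_cvg (T : topologicalType) (K : set T) (u : I -> T) :
  compact K -> (forall i, K (u i)) -> exists l : T, u @ U --> l.
Proof.
move=> cK Ku; have KuU : (u @ U) K.
  have uK : u @^-1` K = setT by apply/seteqP; split=> // i _; exact: Ku.
  by rewrite /= /nbhs /= uK; exact: filterT.
have [l [_ ll]] := cK _ _ KuU.
exists l => V Vl; have [//|UV] := in_ultra_setVsetC (u @^-1` V) UU.
have [y [/= nVy Vy]] := ll (~` V) V UV Vl.
by [].
Qed.

Lemma ultra_bounded_cvg {R : realType} (u : I -> R) (M : R) :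
  (forall i, `|u i| <= M) -> exists l : R, u @ U --> l.
Proof.
move=> uM; apply: (compact_ultra_cvg _ `[- M, M]%classic).
  exact: segment_compact.
by move=> i; rewrite /= in_itv /= -ler_norml.
Qed.

(** Weak* compactness of the dual ball: scalar limits exist pointwise, and linearity and the bound
    survive them. *)
Lemma dual_ultralimit {R : realType} {Z : normedModType R} (f : I -> dual Z) :
  (forall i, `|f i| <= 1) ->
  exists2 g : dual Z, `|g| <= 1 & forall z, (f i z : R) @[i --> U] --> (g z : R).
Proof.
move=> f1.
have fM i z : `|f i z| <= `|z| by rewrite -[leRHS]mul1r dual_le.
have cvf z : exists l : R, (f i z : R) @[i --> U] --> l.
  exact: (ultra_bounded_cvg _ `|z|).
pose g z := sval (cid (cvf z)).
have fg z : (f i z : R) @[i --> U] --> (g z : R) := svalP (cid (cvf z)).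
have lg : linear (g : Z -> R^o).
  move=> a x y; apply: (cvg_unique _ (fg (a *: x + y))) => //.
  rewrite (_ : (fun i => _) = (fun i => a * (f i x : R) + (f i y : R))).
    by apply: cvgD => //; apply: cvgZr.
  by apply/funext => i; rewrite linearP.
have [|G Gg G1] := dual_of_linear g 1 ler01 lg.
  move=> z; rewrite mul1r; apply: (cvgr_to_le (cvg_norm (fg z))).
  by apply: nearW => i; exact: fM.
by exists G => // z; rewrite Gg.
Qed.
End Ultralimits.

(** * Adjoints, rank-one operators and the pairing of [F] with [g] *)

Section Operators.
Context {R : realType} {X Y : normedModType R}.

Lemma near_norming_pair (A : bounded_op X Y) (e : R) : 0 < e ->
  exists x : X, exists h : dual Y, [/\ `|x| <= 1, `|h| <= 1 & `|A| - e < h (A x)].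
Proof.
move=> e0; have [_ [x x1 <-] Ax] := sup_adherent e0 (op_norm_has_sup A).
have [h h1 hA] := norming_functional (A x).
by exists x, h; split => //; rewrite hA.
Qed.

Lemma adjoint_le (A : bounded_op X Y) (g : dual Y) :
  `|adjoint A g| <= `|A| * `|g|.
Proof.
apply: op_norm_lub => x x1 /=; rewrite mulrC.
rewrite (le_trans (op_norm_le g _))// ler_wpM2l ?op_norm_ge0//.
exact: (op_norm_ub A x1).
Qed.

Lemma adjoint_norm (A : bounded_op X Y) : `|adjoint A| = `|A|.
Proof.
apply/eqP; rewrite eq_le; apply/andP; split.
  apply: op_norm_lub => g g1; rewrite (le_trans (adjoint_le _ _))//.
  by rewrite ler_piMr.
apply: op_norm_lub => x x1; have [h h1 <-] := norming_functional (A x).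
have := op_norm_ub (adjoint A) h1.
by apply: le_trans; rewrite (le_trans (ler_norm _))// (op_norm_ub (adjoint A h)).
Qed.

Lemma adjointN (A : bounded_op X Y) (g : dual Y) :
  adjoint A (- g) = - adjoint A g.
Proof. by apply/val_inj/funext. Qed.

Lemma adjoint_linear_op (a : R) (A B : bounded_op X Y) (g : dual Y) :
  adjoint (a *: A + B) g = a *: adjoint A g + adjoint B g.
Proof. by apply/val_inj/funext => x /=; rewrite linearP. Qed.

Lemma adjoint_pairing (F : dual (dual X)) (g : dual Y) :
  `|F| <= 1 -> `|g| <= 1 ->
  exists2 P : dual (compact_op X Y),
    forall A : compact_op X Y, P A = F (adjoint A g) & `|P| <= 1.
Proof.
move=> F1 g1.
have lP : linear ((fun A : compact_op X Y => F (adjoint A g) : R) :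
    compact_op X Y -> R^o).
  by move=> a A B; rewrite adjoint_linear_op linearP.
apply: (@dual_of_linear _ (compact_op X Y) _ _ ler01 lP) => A.
rewrite mul1r (le_trans (dual_le _ _ _ F1))// mul1r.
by rewrite (le_trans (adjoint_le _ _))// ler_piMr.
Qed.

Lemma rank_one (xi : dual X) (y : Y) :
  exists A : compact_op X Y, forall x, A x = (xi x : R) *: y.
Proof.
have bA : (fun x : X => (xi x : R) *: y) \in @bounded_op_pred R X Y.
  apply/asboolP; split.
    by move=> a u v; rewrite linearP scalerDl scalerA.
  move=> x; apply: cvgZl; exact: bounded_op_continuous.
have cA : BoundedOp (fun x : X => (xi x : R) *: y) bA \in @compact_op_pred R X Y.
  apply/asboolP => B [M [_ BM]].
  (* [M + 1] appears because [bounded_set] bounds norms only by numbers strictly above [M]. *)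
  pose K := [set t *: y | t in `[- (`|xi| * (M + 1)), `|xi| * (M + 1)]%classic].
  apply: (@precompact_subset _ _ K).
    move=> _ [x Bx <-] /=; exists (xi x) => //=.
    rewrite in_itv /= -ler_norml (le_trans (op_norm_le xi x))//.
    rewrite ler_wpM2l ?op_norm_ge0//.
    by apply: (BM (M + 1) _ x Bx); rewrite ltrDl.
  apply: compact_precompact; first exact: norm_hausdorff.
  apply: continuous_compact; last exact: segment_compact.
  apply: continuous_subspaceT => t; apply: cvgZl; exact: cvg_id.
by exists (CompactOp cA).
Qed.

(* Weak* convergence of both factors alone would not suffice: compactness of
   [A] makes [A x_i] converge in norm along [U]. *)
Lemma compact_pairing_ultralimit {I : Type} (U : set_system I)
    {UU : UltraFilter U} (x : I -> X) (h : I -> dual Y) :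
  (forall i, `|x i| <= 1) -> (forall i, `|h i| <= 1) ->
  exists F : dual (dual X), exists g : dual Y, [/\ `|F| <= 1, `|g| <= 1 &
    forall A : compact_op X Y,
      (h i (A (x i)) : R) @[i --> U] --> (F (adjoint A g) : R)].
Proof.
move=> x1 h1.
have [g g1 hg] := dual_ultralimit h h1.
(* Embedding the points in the bidual gives them a weak* limit [F]. *)
pose ev i := s2val (cid2 (dual_eval (x i))).
have evE i f : ev i f = f (x i) := s2valP (cid2 (dual_eval (x i))) f.
have ev1 i : `|ev i| <= 1 := le_trans (s2valP' (cid2 (dual_eval (x i)))) (x1 i).
have [F F1 evF] := dual_ultralimit ev ev1.
exists F, g; split => // A.
have [y Axy] : exists y : Y, A (x i) @[i --> U] --> y.
  apply: (compact_ultra_cvg _ (closure (A @` [set z | `|z| <= 1]))).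
    rewrite -precompactE; have /asboolP cA := valP A; apply: cA.
    by exists 1; split => // M M1 z /= z1; rewrite (le_trans z1)// ltW.
  by move=> i; apply: subset_closure; exists (x i) => //; exact: x1.
have evy : (ev i (adjoint A g) : R) @[i --> U] --> (g y : R).
  rewrite (_ : (fun i => _) = (fun i => (g (A (x i)) : R))).
    by apply: continuous_cvg Axy; exact: bounded_op_continuous.
  by apply/funext => i; rewrite evE.
rewrite (cvg_unique (@Rhausdorff R) (evF (adjoint A g)) evy).
(* Split [h i (A (x i))] at [y]: this part is at most [|A (x i) - y|], the other tends to [g y]. *)
have d0 : (h i (A (x i) - y) : R) @[i --> U] --> (0 : R).
  apply/norm_cvg0P.
  apply: (@squeeze_cvgr _ _ _ _ (cst 0) (fun i => `|A (x i) - y|)).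
  - by apply: nearW => i; rewrite normr_ge0 -[leRHS]mul1r dual_le.
  - exact: cvg_cst.
  - rewrite -(normr0 Y) -(subrr y); apply: cvg_norm; apply: cvgB => //.
    exact: cvg_cst.
rewrite -[_ y]add0r.
rewrite (_ : (fun i => _) = (fun i => (h i (A (x i) - y) : R) + (h i y : R))).
  exact: cvgD.
by apply/funext => i; rewrite -linearD subrK.
Qed.
End Operators.

(** * Support functionals of a compact operator *)

Section SmoothPoints.
Context {R : realType}.

Lemma support_norm1 {Z : normedModType R} (u : Z) (f : dual Z) :
  u != 0 -> `|f| <= 1 -> f u = `|u| -> `|f| = 1.
Proof.
move=> u0 f1 fu; apply/eqP; rewrite eq_le f1 /=.
have u_gt0 : 0 < `|u| by rewrite normr_gt0.
rewrite -(ler_pM2r u_gt0) mul1r (le_trans _ (op_norm_le f u))//.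
by rewrite fu ger0_norm.
Qed.

Context {X Y : normedModType R} (T : compact_op X Y).

(** The chain [|T| = F (T^* g) <= |T^* g| <= |T| |g| <= |T|] consists of equalities. *)
Lemma norming_pairP (F : dual (dual X)) (g : dual Y) :
  T != 0 -> `|F| <= 1 -> `|g| <= 1 -> F (adjoint T g) = `|T| ->
  [/\ `|g| = 1, `|adjoint T g| = `|adjoint T|, adjoint T g != 0 &
      F (adjoint T g) = `|adjoint T g|].
Proof.
move=> T0 F1 g1 FT; have T_gt0 : 0 < `|T| by rewrite normr_gt0.
have Tle : `|T| <= `|adjoint T g|.
  by rewrite -FT (le_trans (ler_norm _))// -[leRHS]mul1r dual_le.
have leT : `|adjoint T g| <= `|T| * `|g| := adjoint_le T g.
have Tg : `|adjoint T g| = `|T|.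
  by apply/eqP; rewrite eq_le Tle andbT (le_trans leT)// ler_piMr.
split.
- apply/eqP; rewrite eq_le g1 -(ler_pM2l T_gt0) mulr1.
  exact: le_trans Tle leT.
- by rewrite adjoint_norm.
- by rewrite -normr_gt0 Tg.
- by rewrite Tg.
Qed.

(* Norm [T + A / n] up to [1 / n ^ 2] by pairs [(x_n, h_n)] and pass to an
   ultralimit. *)
Lemma support_le_pairing (P : dual (compact_op X Y)) (A : compact_op X Y) :
  `|P| <= 1 -> P T = `|T| ->
  exists F : dual (dual X), exists g : dual Y,
    [/\ `|F| <= 1, `|g| <= 1, F (adjoint T g) = `|T| & P A <= F (adjoint A g)].
Proof.
move=> P1 PT.
pose e n : R := n.+1%:R^-1.
have e0 n : 0 < e n by rewrite invr_gt0.
have /choice[z zP] n : exists z : X * dual Y, [/\ `|z.1| <= 1, `|z.2| <= 1 &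
    `|T + e n *: A| - e n * e n < z.2 (T z.1 + e n *: A z.1)].
  have [x [h [x1 h1 xh]]] := near_norming_pair (T + e n *: A) _
    (mulr_gt0 (e0 n) (e0 n)).
  by exists (x, h).
have [U [UU ooU]] := ultraFilterLemma (@eventually_filter).
have [F [g [F1 g1 FgP]]] := compact_pairing_ultralimit U
  (fun n => (z n).1) (fun n => (z n).2)
  (fun n => let: And3 h _ _ := zP n in h) (fun n => let: And3 _ h _ := zP n in h).
have hle n (B : compact_op X Y) : `|(z n).2 (B (z n).1)| <= `|B|.
  have [x1 h1 _] := zP n; rewrite (le_trans (dual_le _ _ _ h1))// mul1r.
  exact: (op_norm_ub B x1).
(* The left side is [P (T + e n *: A)] minus the tolerance, and [P] has norm at most 1. *)
have key n : `|T| + e n * P A - e n * e n <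
    (z n).2 (T (z n).1) + e n * (z n).2 (A (z n).1).
  have [_ _] := zP n; have -> : ((z n).2 (T (z n).1 + e n *: A (z n).1) : R) =
      (z n).2 (T (z n).1) + e n * (z n).2 (A (z n).1) by rewrite linearD linearZ.
  apply: le_lt_trans.
  rewrite lerD2r -PT.
  have -> : (P T : R) + e n * P A = P (T + e n *: A) by rewrite linearD linearZ.
  by rewrite (le_trans (ler_norm _))// -[leRHS]mul1r dual_le.
have eU : e @ U --> (0 : R).
  by apply: cvg_trans cvg_harmonic; exact: cvg_fmap2.
have FA := FgP A; have FT := FgP T.
exists F, g; split => //.
  apply/eqP; rewrite eq_le; apply/andP; split.
    rewrite (le_trans (ler_norm _))// (le_trans (dual_le _ _ _ F1))// mul1r.
    by rewrite (le_trans (adjoint_le _ _))// ler_piMr.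
  (* Collects the order [e n] terms of [key]; the 1 absorbs [e n * e n]. *)
  pose M : R := `|P A| + `|A| + 1.
  have : (((z n).2 (T (z n).1) : R) + e n * M) @[n --> U] -->
      (F (adjoint T g) : R) + 0 * M.
    by apply: cvgD => //; apply: cvgMl.
  rewrite mul0r addr0 => /cvgr_to_ge; apply; apply: nearW => n.
  have := key n; have := hle n A; have := ler_norm (- (P A : R)).
  rewrite normrN => PA /(le_trans (ler_norm _)) hA k.
  have en1 : e n <= 1 by rewrite invf_le1 ?ler1n.
  have := e0 n; rewrite /M; nra.
(* Cancelling [|T|] in [key] and dividing by [e n] leaves an error [e n]; hence the squared
   tolerance. *)
have : (((z n).2 (A (z n).1) : R) + e n) @[n --> U] -->
    (F (adjoint A g) : R) + 0 by exact: cvgD.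
rewrite addr0 => /cvgr_to_ge; apply; apply: nearW => n.
have := key n; have /(le_trans (ler_norm _)) := hle n T; have := e0 n.
move=> en0 hT k.
rewrite -(ler_pM2l en0) mulrDr; lra.
Qed.

(** Test on [A x = xi x *: y], whose adjoint sends [k] to [k y *: xi]. *)
Lemma adjoint_pairing_rank_one (F F' : dual (dual X)) (g h : dual Y) :
  (forall A : compact_op X Y, F (adjoint A g) = F' (adjoint A h)) ->
  forall xi y, (F xi : R) * g y = F' xi * h y.
Proof.
move=> FF' xi y; have [A Ay] := rank_one xi y.
have adjA k : adjoint A k = (k y : R) *: xi.
  by apply/val_inj/funext => x /=; rewrite Ay linearZ; exact: mulrC.
by rewrite [LHS]mulrC [RHS]mulrC; have := FF' A; rewrite !adjA !linearZ.
Qed.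

Lemma smooth_norming_pair (P : dual (compact_op X Y)) (F : dual (dual X))
    (g : dual Y) :
  (forall Q : dual (compact_op X Y), `|Q| = 1 /\ Q T = `|T| -> P = Q) ->
  T != 0 -> `|F| <= 1 -> `|g| <= 1 -> F (adjoint T g) = `|T| ->
  forall A : compact_op X Y, F (adjoint A g) = P A.
Proof.
move=> Puniq T0 F1 g1 FT A; have [Q QE Q1] := adjoint_pairing _ _ F1 g1.
have QT : Q T = `|T| by rewrite QE.
by rewrite (Puniq Q) ?QE//; split=> //; exact: support_norm1 T0 Q1 QT.
Qed.
End SmoothPoints.

Theorem corollary4p2p1 (R : realType) (X Y : normedModType R)
    (T : compact_op X Y) :
  smooth_point T <->
  exists g : dual Y,
    [/\ `|g| = 1,
        [set h : dual Y | `|h| = 1 /\ `|adjoint T h| = `|adjoint T|]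
          = [set g; - g]
      & smooth_point (adjoint T g)].
Proof.
have le1 (Z : normedModType R) (f : dual Z) : `|f| = 1 -> `|f| <= 1 by move=> ->.
split=> [[T0 [P [[P1 PT] Puniq]]]|[g [g1 Tg [Tg0 [F [[F1 FTg] Funiq]]]]]].
  have T_neq0 : `|T| != 0 by rewrite normr_eq0.
  (* Only a norming pair is wanted here, so the perturbation is 0. *)
  have [F [g [F1 gle1 FTg _]]] := support_le_pairing T P 0 (le1 _ _ P1) PT.
  have [g1 Tg Tg0 FTg'] := norming_pairP T F g T0 F1 gle1 FTg.
  have rigid := smooth_norming_pair T P _ _ Puniq T0.
  have pair_unique (F' : dual (dual X)) (h : dual Y) :
      `|F'| <= 1 -> `|h| <= 1 -> F' (adjoint T h) = `|T| ->
      forall xi y, (F xi : R) * g y = F' xi * h y.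
    move=> F'1 h1 F'T; apply: adjoint_pairing_rank_one => A.
    by rewrite (rigid _ _ F1 gle1 FTg) (rigid _ _ F'1 h1 F'T).
  exists g; split=> //; last first.
    split=> //; exists F; split=> [|F' [F'1 F'T]].
      by split=> //; exact: support_norm1 Tg0 F1 FTg'.
    have [y gy0] : exists y, g y != 0.
      apply: contrapT => /forallNP g0; have : g != 0 by rewrite -normr_gt0 g1.
      by move/eqP; apply; apply/val_inj/funext => y; have /negP/negPn/eqP := g0 y.
    apply/val_inj/funext => xi; apply: (mulIf gy0).
    by apply: pair_unique; rewrite ?F'1// F'T Tg adjoint_norm.
  apply/seteqP; split=> [h [h1 Th]|h [->|->]]; last first.
  - by split; rewrite ?adjointN normrN.
  - by [].
  have [F' F'1 F'T] := norming_functional (adjoint T h).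
  (* Taking [xi = T^* g] makes [g] a multiple of [h]; equal norms then leave only a sign. *)
  have {}pair_unique y : `|T| * g y = F' (adjoint T g) * h y.
    rewrite -(pair_unique F' h) ?h1// ?FTg//.
    by rewrite F'T Th adjoint_norm.
  pose c : R := `|T|^-1 * F' (adjoint T g).
  have gch : g = c *: h.
    apply/val_inj/funext => y; apply: (mulfI T_neq0).
    rewrite [LHS]pair_unique [RHS](_ : _ = `|T| * (c * h y))//.
    by rewrite /c !mulrA divff// mul1r.
  have /esym/eqP : 1 = `|c|.
    by have := op_normZ c h; rewrite -gch [op_norm g]g1 [op_norm h]h1 mulr1.
  rewrite eqr_norml ler01 andbT => /orP[]/eqP c1.
    by left; rewrite gch c1 scale1r.
  by right; rewrite gch c1 scaleN1r opprK.
have [_ TgT] : [set h : dual Y | `|h| = 1 /\ `|adjoint T h| = `|adjoint T|] g.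
  by rewrite Tg; left.
have T0 : T != 0.
  apply: contra_neq Tg0 => ->; apply/val_inj/funext => x /=.
  exact: (linear0 g).
have [P PE P1] := adjoint_pairing F g (le1 _ _ F1) (le1 _ _ g1).
have PT : P T = `|T| by rewrite PE FTg TgT adjoint_norm.
split=> //; exists P; split=> [|Q [Q1 QT]].
  by split=> //; exact: support_norm1 T0 P1 PT.
(* Domination at [A] and at [- A] gives equality. *)
suff QleP A : Q A <= P A.
  apply/val_inj/funext => A; apply/eqP; rewrite eq_le QleP andbT.
  by rewrite -lerN2 -!linearN QleP.
have [F' [h [F'1 hle1 F'T QA]]] := support_le_pairing T Q A (le1 _ _ Q1) QT.
have [h1 Th Th0 F'Th] := norming_pairP T F' h T0 F'1 hle1 F'T.
have F'n := support_norm1 _ _ Th0 F'1 F'Th.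
rewrite (le_trans QA)// PE; have [hg|hg] : [set g; - g] h by rewrite -Tg.
  by rewrite (Funiq F') ?hg//; split=> //; rewrite -hg.
(* For [h = - g] the functional [- F'] supports [T^* g], and the two signs cancel. *)
rewrite (Funiq (- F')); first by rewrite hg adjointN linearN.
split; first by rewrite normrN.
by move: F'Th; rewrite hg adjointN normrN linearN.
Qed.
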